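(* Let $S\in\mathbb{R}^{n\times n}$ be symmetric with zero diagonal, $\mu\in\mathbb{R}^n$, $\alpha\ge 0$, and assume $(\alpha^2-1)I+S\succeq 0$ (positive semidefinite). Let $U_{\Box,\alpha}$, $U_{p,\alpha}$ and $E$ be as defined in the context. (i) $U_{\Box,\alpha}$ is concave on $[-1,1]^n$. Moreover $\arg\min_{\mathbf{x}\in[-1,1]^n}U_{\Box,\alpha}(\mathbf{x})\cap\{-1,1\}^n\neq\varnothing$, and the vertices in $\{-1,1\}^n$ that minimize $U_{\Box,\alpha}$ over $[-1,1]^n$ are exactly the minimizers of $E$ over $\{-1,1\}^n$. (ii) Let $\mathbf{x}_p$ be global minimizers of $U_{p,\alpha}$ on $\mathbb{R}^n$, with $p\to\infty$. Assume that for every $\mathbf{v}\in\{-1,1\}^n$ such that $\operatorname{sgn}(\mathbf{x}_p)=\mathbf{v}$ for infinitely many indices $p$, there exists a compact set $K_{\mathbf{v}}\subset[-1,1]^n$ containing all points $\mathbf{x}_p$ of that recurring subsequence (i.e. all $\mathbf{x}_p$ with $\operatorname{sgn}(\mathbf{x}_p)=\mathbf{v}$). Then for all sufficiently large $p$, $\operatorname{sgn}(\mathbf{x}_p)$ is a global minimizer of $E$ over $\{-1,1\}^n$.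
   Context: The Ising energy is $E(\mathbf{v})=-\tfrac12\mathbf{v}^{\mathsf T}S\mathbf{v}-\mu\cdot\mathbf{v}$ for $\mathbf{v}\in\{-1,1\}^n$. The hard-box objective is $U_{\Box,\alpha}(\mathbf{x})=\tfrac{1-\alpha^2}{2}\|\mathbf{x}\|^2-\tfrac12\mathbf{x}^{\mathsf T}S\mathbf{x}-\mu\cdot\mathbf{x}$ (the same formula is used on all of $\mathbb{R}^n$ when needed). For integers $p\ge2$, $\Phi_p(\mathbf{x})=\sum_{i=1}^n|x_i|^{2p}/(2p)$ and $U_{p,\alpha}(\mathbf{x})=\Phi_p(\mathbf{x})+U_{\Box,\alpha}(\mathbf{x})$ for $\mathbf{x}\in\mathbb{R}^n$. The sign readout $\operatorname{sgn}$ is applied coordinatewise and takes values in $\{-1,1\}$: $\operatorname{sgn}(t)=1$ for $t>0$, $\operatorname{sgn}(t)=-1$ for $t<0$, and $\operatorname{sgn}(0)=1$ by convention. *)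

(* Defs.v *)
From HB Require Import structures.
From mathcomp Require Export all_boot all_order all_algebra.
From mathcomp Require Export all_classical all_reals all_analysis.

Set Implicit Arguments.
Unset Strict Implicit.
Unset Printing Implicit Defensive.

Import Order.TTheory GRing.Theory Num.Theory.
Export numFieldNormedType.Exports.

Local Open Scope classical_set_scope.
Local Open Scope ring_scope.

Section IsingDefs.
Context {R : realType} {n : nat}.
Implicit Types (S A : 'M[R]_n) (mu x v : 'cV[R]_n) (alpha : R) (p : nat).

Definition dotv x v : R := \sum_(i < n) x i 0 * v i 0.

Definition quad A x : R := dotv x (A *m x).

(* Symmetry of A is not part of this predicate. *)
Definition psdmx A : Prop := forall x, 0 <= quad A x.

Definition spins : set 'cV[R]_n := [set v | forall i, v i 0 = 1 \/ v i 0 = -1].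

Definition cube : set 'cV[R]_n := [set x | forall i, -1 <= x i 0 <= 1].

Definition ising_energy S mu v : R := - (2^-1 * quad S v) - dotv mu v.

(* The norm here is Euclidean, [dotv x x]; the library norm `|x| on matrices
   is the sup norm. *)
Definition Ubox S mu alpha x : R :=
  (1 - alpha ^+ 2) / 2 * dotv x x - 2^-1 * quad S x - dotv mu x.

Definition Phi p x : R := \sum_(i < n) `|x i 0| ^+ (2 * p) / (2 * p)%:R.

Definition Up S mu alpha p x : R := Phi p x + Ubox S mu alpha x.

Definition argmin (D : set 'cV[R]_n) (f : 'cV[R]_n -> R) : set 'cV[R]_n :=
  [set x | D x /\ forall y, D y -> f x <= f y].

Definition concave_on (D : set 'cV[R]_n) (f : 'cV[R]_n -> R) : Prop :=
  convex_function D (fun x => - f x).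

(* [Num.sg] does not fit: it sends 0 to 0, while the readout sends 0 to 1. *)
Definition sign_readout x : 'cV[R]_n :=
  map_mx (fun t : R => if 0 <= t then 1 else -1) x.

End IsingDefs.

(* Main.v *)
(* Because S has zero diagonal, E is affine in each coordinate, and because
   alpha^2 >= 1, the box objective satisfies
   U >= (1 - alpha^2) n / 2 + E on the cube, with equality at the spins.
   Rounding coordinates one at a time shows that E is minimized over the cube at
   spins, hence so is U.

   For (ii), if x lies in the cube and has sign pattern v, then v carries weight
   at least 2^-n in the product measure on spins with mean x, so
   E(v) - min E <= 2^n (E(x) - min E), while the penalty at a spin costs only
   n / (2p).  Thus E(v) - min E <= 2^n n / (2p), which forces E(v) = min E for
   large p, there being finitely many v. *)
Require Import Defs.
From mathcomp Require Import all_boot all_order all_algebra.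
From mathcomp Require Import all_classical all_reals all_analysis.
From mathcomp Require Import ring lra.

Set Implicit Arguments.
Unset Strict Implicit.
Unset Printing Implicit Defensive.

Import Order.TTheory GRing.Theory Num.Theory.
Import numFieldNormedType.Exports.

Local Open Scope classical_set_scope.
Local Open Scope ring_scope.

(** * Expansion of quadratic forms along a line *)

Section BilinearExpansion.
Context {R : realType} {n : nat}.
Implicit Types (A : 'M[R]_n) (x y z : 'cV[R]_n).

Lemma dotvDl x y z : dotv (x + y) z = dotv x z + dotv y z.
Proof. by rewrite -big_split; apply: eq_bigr => i _; rewrite mxE mulrDl. Qed.

Lemma dotvZl c x y : dotv (c *: x) y = c * dotv x y.
Proof. by rewrite mulr_sumr; apply: eq_bigr => i _; rewrite mxE mulrA. Qed.

Lemma dotvC x y : dotv x y = dotv y x.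
Proof. by apply: eq_bigr => i _; rewrite mulrC. Qed.

Lemma dotvDr x y z : dotv x (y + z) = dotv x y + dotv x z.
Proof. by rewrite dotvC dotvDl !(dotvC x). Qed.

Lemma dotvZr c x y : dotv x (c *: y) = c * dotv x y.
Proof. by rewrite dotvC dotvZl dotvC. Qed.

Lemma dotv_delta i x : dotv (delta_mx i 0) x = x i 0.
Proof.
rewrite /dotv (bigD1 i) //= mxE !eqxx mul1r big1 ?addr0 // => j /negPf ji.
by rewrite mxE ji mul0r.
Qed.

Lemma quadDZ A x y c : quad A (x + c *: y) =
  quad A x + c * (dotv x (A *m y) + dotv y (A *m x)) + c ^+ 2 * quad A y.
Proof.
rewrite /quad mulmxDr -scalemxAr !dotvDl !dotvDr !dotvZl !dotvZr; ring.
Qed.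

Lemma quad_delta A i : quad A (delta_mx i 0) = A i i.
Proof. by rewrite /quad dotv_delta -colE mxE. Qed.

Lemma quad_scalar_mxD A a x : quad (a%:M + A) x = a * dotv x x + quad A x.
Proof. by rewrite /quad mulmxDl mul_scalar_mx dotvDr dotvZr. Qed.

End BilinearExpansion.

(** * Multiaffine functions on the cube *)

Section MultiAffine.
Context {R : realType} {n : nat}.
Implicit Types (x v w : 'cV[R]_n) (f : 'cV[R]_n -> R).

Definition set_coord x (i : 'I_n) (c : R) : 'cV[R]_n :=
  x + (c - x i 0) *: delta_mx i 0.

Lemma set_coordE x i c j :
  set_coord x i c j 0 = if j == i then c else x j 0.
Proof.
rewrite !mxE eqxx andbT; case: eqP => [->|_]; last by rewrite mulr0 addr0.
by rewrite mulr1 addrC subrK.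
Qed.

(** The weights are the probabilities of 1 and -1 for a two-valued variable of mean [x i 0]; on the
    cube they are nonnegative. *)
Definition multiaffine f := forall x i,
  f x = (1 + x i 0) / 2 * f (set_coord x i 1)
        + (1 - x i 0) / 2 * f (set_coord x i (-1)).

Lemma spins_cube : spins `<=` (cube : set 'cV[R]_n).
Proof. by move=> v vs i; case: (vs i) => ->; apply/andP; split; lra. Qed.

Lemma set_coord_cube x i c : cube x -> -1 <= c <= 1 -> cube (set_coord x i c).
Proof. by move=> xc cc j; rewrite set_coordE; case: eqP. Qed.

(** A convex combination is at least its smaller term, so moving a coordinate to the better endpoint
    never raises [f]. *)
Lemma multiaffine_round f x : multiaffine f -> cube x ->
  exists2 w, spins w & f w <= f x.
Proof.
move=> faff xc.
suff H (s : seq 'I_n) : exists y, [/\ cube y, f y <= f x &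
    forall i, i \in s -> y i 0 = 1 \/ y i 0 = -1].
  have [y [_ yx ys]] := H (enum 'I_n).
  by exists y => // i; apply: ys; rewrite mem_enum.
elim: s => [|i s [y [yc yx ys]]]; first by exists x; split.
have spin_after c : c = 1 \/ c = -1 -> forall j, j \in i :: s ->
    set_coord y i c j 0 = 1 \/ set_coord y i c j 0 = -1.
  move=> cs j; rewrite set_coordE inE; case: eqP => //= _; exact: ys.
have /andP[yi_ge yi_le] := yc i.
have := faff y i.
have [le_pm|lt_mp] := leP (f (set_coord y i 1)) (f (set_coord y i (-1))) => fy.
  exists (set_coord y i 1); split; last by apply: spin_after; left.
    by apply: set_coord_cube => //; apply/andP; split; lra.
  by apply: le_trans yx; rewrite fy; nra.
exists (set_coord y i (-1)); split; last by apply: spin_after; right.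
  by apply: set_coord_cube => //; apply/andP; split; lra.
by apply: le_trans yx; rewrite fy; nra.
Qed.

(* Each coordinate of [x] is moved in turn to the endpoint on its own side of
   0; that endpoint has weight at least 1/2 in the affine interpolation, so
   each move at most doubles [f]. *)
Lemma multiaffine_orthant f x v : multiaffine f ->
    (forall y, cube y -> 0 <= f y) -> cube x -> spins v ->
    (forall i, 0 <= v i 0 * x i 0) ->
  f v <= 2 ^+ n * f x.
Proof.
move=> faff f_ge0 xc vs vx.
pose y (s : seq 'I_n) : 'cV[R]_n :=
  \col_j (if j \in s then v j 0 else x j 0).
have yc s : cube (y s).
  by move=> j; rewrite mxE; case: ifP => _; [exact: spins_cube | exact: xc].
have yS i s : y (i :: s) = set_coord (y s) i (v i 0).
  apply/colP => j; rewrite set_coordE !mxE inE.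
  by case: eqP => [->|] //=.
have yv s i : 0 <= v i 0 * y s i 0.
  by rewrite mxE; case: ifP => _ //; rewrite -expr2 sqr_ge0.
have H s : f (y s) <= 2 ^+ size s * f x.
  elim: s => [|i s IH] /=.
    rewrite expr0 mul1r; suff -> : y [::] = x by [].
    by apply/colP => j; rewrite mxE.
  rewrite exprS -mulrA; apply: le_trans (ler_wpM2l _ IH); last by [].
  rewrite yS (faff (y s) i).
  have /andP[yi_ge yi_le] := yc s i.
  have fp : 0 <= f (set_coord (y s) i 1).
    by apply/f_ge0/set_coord_cube => //; apply/andP; split; lra.
  have fm : 0 <= f (set_coord (y s) i (-1)).
    by apply/f_ge0/set_coord_cube => //; apply/andP; split; lra.
  have := yv s i.
  by case: (vs i) => ->; nra.
have := H (enum 'I_n); rewrite size_enum_ord; congr (f _ <= _).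
by apply/colP => j; rewrite mxE mem_enum.
Qed.

End MultiAffine.

(** * Spins as a finite set, and the sign readout *)

Section Spins.
Context {R : realType} {n : nat}.

Definition spin_of (b : {ffun 'I_n -> bool}) : 'cV[R]_n :=
  \col_i (if b i then 1 else -1).

Lemma spin_of_spins b : spins (spin_of b).
Proof. by move=> i; rewrite mxE; case: (b i); [left | right]. Qed.

Lemma spinsP (v : 'cV[R]_n) : spins v -> exists b, v = spin_of b.
Proof.
move=> vs; exists [ffun i => v i 0 == 1]; apply/colP => i; rewrite mxE ffunE.
by case: (vs i) => ->; rewrite ?eqxx // lt_eqF // (lt_trans (ltrN10 _)).
Qed.

Lemma argmin_spins_nonempty (f : 'cV[R]_n -> R) : argmin spins f !=set0.
Proof.
(* The constant function only witnesses that the index type is inhabited. *)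
pose b := [arg min_(c < ([ffun=> true] : {ffun 'I_n -> bool})) f (spin_of c)]%O.
exists (spin_of b); split; first exact: spin_of_spins.
move=> _ /spinsP[c ->].
by rewrite /b; case: arg_minP => // d _; apply.
Qed.

Lemma sign_readout_spins (x : 'cV[R]_n) : spins (sign_readout x).
Proof. by move=> i; rewrite mxE; case: ifP; [left | right]. Qed.

Lemma sign_readout_mul_ge0 (x : 'cV[R]_n) i : 0 <= sign_readout x i 0 * x i 0.
Proof. by rewrite mxE; case: (leP 0 (x i 0)) => ?; lra. Qed.

End Spins.

(** * Energy and box objective *)

Section Ising.
Context {R : realType} {n : nat} (S : 'M[R]_n) (mu : 'cV[R]_n) (alpha : R).
Implicit Types x v : 'cV[R]_n.

(** The coefficient of the square of coordinate [i] is a multiple of [S i i], which vanishes. *)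
Lemma ising_multiaffine :
  (forall i, S i i = 0) -> multiaffine (ising_energy S mu).
Proof.
move=> S0 x i; rewrite /ising_energy /set_coord !quadDZ quad_delta S0.
by rewrite !dotvDr !dotvZr; field.
Qed.

Lemma UboxE x :
  Ubox S mu alpha x = (1 - alpha ^+ 2) / 2 * dotv x x + ising_energy S mu x.
Proof. by rewrite /Ubox /ising_energy addrA. Qed.

Lemma Ubox_quadE x : Ubox S mu alpha x =
  - (2^-1 * quad ((alpha ^+ 2 - 1)%:M + S) x) - dotv mu x.
Proof. by rewrite quad_scalar_mxD /Ubox; field. Qed.

Lemma dotv_spins v : spins v -> dotv v v = n%:R.
Proof.
move=> vs; rewrite /dotv (eq_bigr (fun=> 1)) ?sumr_const ?card_ord // => i _.
by case: (vs i) => ->; rewrite ?mulrNN mulr1.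
Qed.

Lemma Phi_spins p v : spins v -> Phi p v = n%:R / (2 * p)%:R.
Proof.
move=> vs; rewrite /Phi (eq_bigr (fun=> (2 * p)%:R^-1)).
  by rewrite sumr_const card_ord mulr_natl.
move=> i _.
have -> : `|v i 0| = 1 by case: (vs i) => ->; rewrite ?normrN normr1.
by rewrite expr1n mul1r.
Qed.

Lemma Phi_ge0 p x : 0 <= Phi p x.
Proof. by apply: sumr_ge0 => i _; rewrite divr_ge0 ?exprn_ge0. Qed.

Lemma Ubox_concave :
  psdmx ((alpha ^+ 2 - 1)%:M + S) -> concave_on cube (Ubox S mu alpha).
Proof.
set A := _ + S => Apsd t x y _ _.
change 'cV[R]_n in x, y.
pose d := x - y.
(* With both points written as [y] plus a multiple of [d], [quadDZ] expands all terms in the same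
   quantities. *)
have xE : x = y + 1 *: d by rewrite scale1r /d addrC subrK.
have tE : (t%:num *: x + (1 - t%:num) *: y : 'cV[R]_n) = y + t%:num *: d.
  by rewrite /d scalerBr scalerBl scale1r addrCA.
change (- Ubox S mu alpha (t%:num *: x + (1 - t%:num) *: y) <=
  t%:num * - Ubox S mu alpha x + (1 - t%:num) * - Ubox S mu alpha y).
rewrite tE !Ubox_quadE -/A [in X in _ <= X]xE.
rewrite !quadDZ !dotvDr !dotvZr.
have t0 : 0 <= t%:num by [].
have t1 : 0 <= 1 - t%:num by rewrite subr_ge0.
(* The convexity gap of [- Ubox] is exactly t(1 - t)/2 times [quad A d]. *)
have := mulr_ge0 (mulr_ge0 t0 t1) (Apsd d); lra.
Qed.

Context (S_psd : psdmx ((alpha ^+ 2 - 1)%:M + S)).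
Context (S_diag0 : forall i, S i i = 0).

Let C := (1 - alpha ^+ 2) / 2 * n%:R : R.

Lemma Ubox_spins v : spins v -> Ubox S mu alpha v = C + ising_energy S mu v.
Proof. by move=> vs; rewrite UboxE dotv_spins. Qed.

Lemma Ubox_cube_ge x :
  cube x -> C + ising_energy S mu x <= Ubox S mu alpha x.
Proof.
move=> xc; rewrite UboxE lerD2r /C.
have -> : n%:R = \sum_(i < n) (1 : R) by rewrite sumr_const card_ord.
rewrite /dotv !mulr_sumr; apply: ler_sum => i _.
(* Testing semidefiniteness on a basis vector gives alpha^2 >= 1. *)
have := S_psd (delta_mx i 0); rewrite quad_delta !mxE eqxx S_diag0 addr0.
rewrite mulr1n => a_ge1; have /andP[xi_ge xi_le] := xc i.
have : 0 <= (1 - x i 0) * (1 + x i 0) by rewrite mulr_ge0; lra.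
move: (alpha ^+ 2) a_ge1 => a a_ge1 x_sq; have := mulr_ge0 a_ge1 x_sq; lra.
Qed.

Lemma argmin_Ubox_spins : argmin cube (Ubox S mu alpha) `&` spins =
  argmin spins (ising_energy S mu).
Proof.
apply/seteqP; split=> v.
  move=> [[_ vmin] vs]; split=> // w ws.
  by have := vmin _ (spins_cube ws); rewrite !Ubox_spins // lerD2l.
move=> [vs vmin]; split=> //; split=> [|y yc]; first exact: spins_cube.
have [w ws wy] := multiaffine_round (ising_multiaffine S_diag0) yc.
apply: le_trans (Ubox_cube_ge yc); rewrite Ubox_spins // lerD2l.
exact: le_trans (vmin _ ws) wy.
Qed.

(* The penalty contributes at most n/(2p) to the minimum of [Up], while the
   orthant of a spin [v] carries at least a 2^-n share of its excess energy. *)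
Lemma Up_argmin_gap p x w : argmin setT (Up S mu alpha p) x -> cube x ->
    argmin spins (ising_energy S mu) w ->
  ising_energy S mu (sign_readout x) - ising_energy S mu w <=
    2 ^+ n * (n%:R / (2 * p)%:R).
Proof.
move=> [_ xmin] xc [ws wmin].
pose f y := ising_energy S mu y - ising_energy S mu w.
have fE y : ising_energy S mu y - ising_energy S mu w = f y by [].
have faff : multiaffine f.
  (* The weights sum to 1, so subtracting a constant is harmless. *)
  by move=> y i; rewrite /f (ising_multiaffine S_diag0 y i); field.
have f_ge0 y : cube y -> 0 <= f y.
  move=> yc; rewrite subr_ge0.
  have [u us uy] := multiaffine_round (ising_multiaffine S_diag0) yc.
  exact: le_trans (wmin _ us) uy.
rewrite fE; apply: le_trans (multiaffine_orthant faff f_ge0 xc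
  (sign_readout_spins x) (sign_readout_mul_ge0 x)) _.
rewrite ler_wpM2l ?exprn_ge0 // /f.
(* Compare [x] with the competitor [w], where the penalty is exactly n/(2p). *)
have := xmin w I; rewrite /Up (Phi_spins p ws) (Ubox_spins ws).
have := Ubox_cube_ge xc; have := Phi_ge0 p x; lra.
Qed.

End Ising.

(** * Passage to large p *)

Lemma finite_set_nat_near (A : set nat) :
  finite_set A -> \forall p \near \oo, ~ A p.
Proof.
move=> /finite_seqP[s ->]; exists (\max_(p <- s) p).+1 => // p /= lt_p ps.
by move: lt_p; rewrite ltnNge (@leq_bigmax_seq _ s xpredT id).
Qed.

Theorem theorem5 (R : realType) (n : nat) (S : 'M[R]_n) (mu : 'cV[R]_n)
    (alpha : R)
    (S_sym : S^T = S)
    (S_diag0 : forall i : 'I_n, S i i = 0)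
    (alpha_ge0 : 0 <= alpha)
    (S_psd : psdmx ((alpha ^+ 2 - 1)%:M + S)) :
  [/\ concave_on cube (Ubox S mu alpha),
      argmin cube (Ubox S mu alpha) `&` spins !=set0 &
      argmin cube (Ubox S mu alpha) `&` spins = argmin spins (ising_energy S mu)]
  /\
  (forall (P : set nat) (x : nat -> 'cV[R]_n),
     infinite_set P ->
     (forall p : nat, P p -> (2 <= p)%N) ->
     (forall p : nat, P p -> argmin [set: 'cV[R]_n] (Up S mu alpha p) (x p)) ->
     (forall v : 'cV[R]_n, spins v ->
        infinite_set [set p | P p /\ sign_readout (x p) = v] ->
        exists K : set 'cV[R]_n,
          [/\ compact K, K `<=` cube &
              forall p : nat, P p -> sign_readout (x p) = v -> K (x p)]) ->
     \forall p \near \oo,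
       P p -> argmin spins (ising_energy S mu) (sign_readout (x p))).
Proof.
have Uargmin := argmin_Ubox_spins mu S_psd S_diag0.
split.
  split=> //; first exact: Ubox_concave.
  by rewrite Uargmin; exact: argmin_spins_nonempty.
move=> P x _ _ xmin recurring.
have [w wmin] := argmin_spins_nonempty (ising_energy S mu).
suff: \forall p \near \oo, forall b : {ffun 'I_n -> bool},
    P p -> sign_readout (x p) = spin_of b ->
    ising_energy S mu (spin_of b) <= ising_energy S mu w.
  apply: filterS => p near_p Pp.
  have [b xb] := spinsP (sign_readout_spins (x p)).
  split=> [|v vs]; first exact: sign_readout_spins.
  by rewrite xb (le_trans (near_p _ Pp xb)) // wmin.2.
(* There are finitely many sign patterns, so each may have its own threshold. *)
apply: filter_forall => b.
pose A := [set p | P p /\ sign_readout (x p) = spin_of b].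
(* A pattern that does not recur is eventually absent; only a recurring one comes with a set [K]
   inside the cube. *)
have [fin|inf] := pselect (finite_set A).
  by apply: filterS (finite_set_nat_near fin) => p notin Pp xb; case: notin.
have [K [_ Kcube xK]] := recurring _ (spin_of_spins b) inf.
have [le_bw|gap] := leP (ising_energy S mu (spin_of b))
  (ising_energy S mu w).
  by exists 0%N.
pose g := ising_energy S mu (spin_of b) - ising_energy S mu w.
have g_gt0 : 0 < g by rewrite subr_gt0.
near=> p => Pp xb.
have := Up_argmin_gap S_psd S_diag0 (xmin p Pp) (Kcube _ (xK _ Pp xb)) wmin.
rewrite xb -/g => gp; exfalso.
(* The gap bound says p <= 2^n n/(2g), so exceeding twice that value is a contradiction. *)
have : 2 ^+ n * n%:R / g < p%:R by near: p; exact: nbhs_infty_gtr.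
have p_gt0 : 0 < p%:R :> R by rewrite ltr0n; near: p; exact: nbhs_infty_gt.
rewrite ltr_pdivrMr //; apply/negP; rewrite -leNgt.
move: gp; rewrite mulrA ler_pdivlMr.
  by rewrite natrM; nra.
by rewrite natrM mulr_gt0.
Unshelve. all: by end_near.
Qed.
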